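(* Let $n\ge2$. The automorphism group (in the category of posets) of $C_n$ is the dihedral group $D_n$ on $n$ points.
   Context: $C_n$ is the poset, ordered by inclusion, whose elements are the subsets $\{1\},\dots,\{n\}$ and $\{1,2\},\{2,3\},\dots,\{n-1,n\},\{n,1\}$ of $\{1,\dots,n\}$. $D_n$ is the dihedral group on $n$ objects, i.e. the subgroup of the permutation group of $\{1,\dots,n\}$ (viewed as cyclically ordered points) generated by the rotation $i\mapsto i+1$ and the reflection $i\mapsto -i$ (indices modulo $n$). *)

(* Defs.v *)
From HB Require Import structures.
From mathcomp Require Import all_boot all_order all_fingroup.

Set Implicit Arguments.
Unset Strict Implicit.
Unset Printing Implicit Defensive.

Import Order.TTheory Order.DefaultSetSubsetOrder GroupScope.

(* The n cyclically ordered points 1, ..., n are the residues modulo n, i.e.  *)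
(* the elements of 'I_n, the point n being represented by 0; ordS is the      *)
(* cyclic successor i |-> i + 1 mod n.                                        *)

Definition in_cycle_poset n : pred {set 'I_n} :=
  fun A => [exists i, (A == [set i]) || (A == [set i; ordS i])].

Record cycle_poset n := CyclePoset {
  cycle_poset_val :> {set 'I_n};
  cycle_poset_valP : in_cycle_poset cycle_poset_val }.

HB.instance Definition _ n := [isSub for @cycle_poset_val n].
HB.instance Definition _ n := [Finite of cycle_poset n by <:].
HB.instance Definition _ n :=
  [SubChoice_isSubPOrder of cycle_poset n by <: with Order.Disp tt tt].

Lemma cycle_poset_leE n (x y : cycle_poset n) :
  (x <= y)%O = (val x \subset val y).
Proof. by []. Qed.

Section PosetAut.
Context {d : Order.disp_t} (P : finPOrderType d).

Definition monotone_map (f : P -> P) : bool :=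
  [forall x, forall y, (x <= y)%O ==> (f x <= f y)%O].

(* Isomorphisms in the category of posets: the inverse must be monotone too.  *)
Definition poset_aut : {set {perm P}} :=
  [set s : {perm P} | monotone_map s && monotone_map s^-1].

Lemma poset_aut_group_set : group_set poset_aut.
Proof.
have mono1 : monotone_map (1 : {perm P}).
  by apply/'forall_forallP => x y; apply/implyP; rewrite !perm1.
have monoM (s t : {perm P}) :
    monotone_map s -> monotone_map t -> monotone_map (s * t).
  move=> /'forall_forallP hs /'forall_forallP ht.
  apply/'forall_forallP => x y; apply/implyP => le_xy; rewrite !permM.
  by apply: (implyP (ht _ _)); apply: (implyP (hs _ _)).
apply/group_setP; split=> [|s t]; first by rewrite inE invg1 mono1.
rewrite !inE invMg => /andP[s1 s2] /andP[t1 t2].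
by rewrite !monoM.
Qed.
Canonical poset_aut_group := Group poset_aut_group_set.

End PosetAut.

Definition rotation n : {perm 'I_n} := perm (@ordS_inj n).

Definition reflection n : {perm 'I_n} :=
  perm (inj_comp (@ordS_inj n) (@rev_ord_inj n)).

Lemma rotationE n (i : 'I_n) : rotation n i = i.+1 %% n :> nat.
Proof. by rewrite permE. Qed.

(* The reflection is i |-> - i modulo n. *)
Lemma reflectionE n (i : 'I_n) : reflection n i = (n - i) %% n :> nat.
Proof. by rewrite permE /= subnSK. Qed.

Definition dihedral n : {group {perm 'I_n}} :=
  <<[set rotation n; reflection n]>>%G.

(* Main.v *)
Require Import Defs.
From mathcomp Require Import all_boot all_order all_fingroup.
From mathcomp Require Import ssralg zmodp.

Set Implicit Arguments.
Unset Strict Implicit.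
Unset Printing Implicit Defensive.

(** Ordered by inclusion, C_n remembers its n points as its minimal elements,
    the singletons.  An automorphism of the poset permutes them, and it is
    determined by the permutation g of the points so obtained: each element of
    C_n is the set of the points below it, so the automorphism is A |-> g(A)
    ([poset_aut_induced]).  Hence Aut C_n is the stabiliser, inside the group
    of all permutations of the points, of the family C_n of sets: it acts on
    C_n faithfully and by automorphisms.

    It remains to see that this stabiliser is D_n ([astabs_cycle_poset]).  A
    permutation in it sends neighbours on the cycle to neighbours.  Composing
    it with rotations and possibly the reflection makes it fix two consecutive
    points, and then it is the identity, by walking along the cycle: when i - 1
    and i are fixed, i + 1 must go to a neighbour of i, and it can go to i - 1
    only if it is i - 1, by injectivity ([astabs_cycle_poset_rigid]).  No case
    distinction is needed for n = 2, where i - 1 and i + 1 coincide. *)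

(** * Automorphisms of the poset come from permutations of the points *)

Section Points.

Import GroupScope.
Variable n : nat.
Implicit Types (i j : 'I_n) (g : {perm 'I_n}) (x : cycle_poset n).

Local Notation stab := 'N([set A | @in_cycle_poset n A] | 'P^*).

Lemma in_cycle_poset1 i : in_cycle_poset [set i].
Proof. by apply/existsP; exists i; rewrite eqxx. Qed.

Lemma in_cycle_poset2 i : in_cycle_poset [set i; ordS i].
Proof. by apply/existsP; exists i; rewrite eqxx orbT. Qed.

Definition vertex i : cycle_poset n := CyclePoset (in_cycle_poset1 i).

Lemma vertex_le i x : (vertex i <= x)%O = (i \in val x).
Proof. by rewrite cycle_poset_leE sub1set. Qed.

Lemma cycle_poset_neq0 x : exists i, i \in val x.
Proof.
have /existsP[i /orP[]/eqP xE] := cycle_poset_valP x.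
  by exists i; rewrite [val x]xE set11.
by exists i; rewrite [val x]xE set21.
Qed.

Lemma le_vertex i x : (x <= vertex i)%O -> x = vertex i.
Proof.
rewrite cycle_poset_leE subset1 => /orP[/eqP xi | /eqP x0]; first exact: val_inj.
by have [j] := cycle_poset_neq0 x; rewrite x0 inE.
Qed.

Lemma poset_autP (s : {perm cycle_poset n}) :
  reflect (forall x y, (s x <= s y)%O = (x <= y)%O)
          (s \in poset_aut (cycle_poset n)).
Proof.
rewrite inE; apply: (iffP andP) => [[/'forall_forallP s1 /'forall_forallP s2]|sP].
  move=> x y; apply/idP/idP; last exact: implyP (s1 x y).
  by move/(implyP (s2 _ _)); rewrite !permK.
split; apply/'forall_forallP => x y; apply/implyP; first by rewrite sP.
by rewrite -{1}(permKV s x) -{1}(permKV s y) sP.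
Qed.

(** The vertices are the minimal elements, so s permutes them; s x is then
    recovered from the vertices below it, which are the images of those below
    x. *)
Lemma poset_aut_induced (s : {perm cycle_poset n}) :
  s \in poset_aut (cycle_poset n) ->
  exists g, forall x, val (s x) = [set g i | i in val x].
Proof.
move=> /poset_autP sP.
have s_vertex i : {j | s (vertex i) == vertex j}.
  apply: sigW; have [j sij] := cycle_poset_neq0 (s (vertex i)); exists j.
  move: sij; rewrite -vertex_le -{1}(permKV s (vertex j)) sP => /le_vertex <-.
  by rewrite permKV.
pose h i := sval (s_vertex i).
have hE i : s (vertex i) = vertex (h i) by apply/eqP; exact: svalP (s_vertex i).
have h_inj : injective h.
  move=> i j eq_h; have : s (vertex i) = s (vertex j) by rewrite !hE eq_h.
  by move/perm_inj/(congr1 val)/set1_inj.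
exists (perm h_inj) => x; apply/setP => j.
rewrite -{1}(permKV (perm h_inj) j) permE -vertex_le -hE sP vertex_le.
by rewrite -{2}(permKV (perm h_inj) j) mem_imset //; exact: perm_inj.
Qed.

Lemma astabs_cycle_posetP g :
  reflect (forall A : {set 'I_n}, in_cycle_poset A -> in_cycle_poset (g @: A))
          (g \in stab).
Proof.
rewrite !inE; apply: (iffP subsetP) => gP A; have:= gP A; rewrite !inE //.
Qed.

Local Notation induced := (actperm (subaction (cycle_poset n) 'P^*)).

Lemma val_induced g x : g \in stab ->
  val (induced g x) = [set g i | i in val x].
Proof. by move=> Ng; rewrite actpermE val_subact Ng. Qed.

(** Faithful already on the vertices. *)
Lemma injm_induced : 'injm induced.
Proof.
apply/subsetP => g /morphpreP[Ng /set1P g1]; apply/set1P/permP => i.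
have := val_induced (vertex i) Ng.
by rewrite g1 !perm1 imset_set1 => /set1_inj.
Qed.

(** Surjectivity: the permutation of the points underlying an automorphism s
    preserves the family, because its value on a member x is the member s x. *)
Lemma isom_induced : isom stab (poset_aut (cycle_poset n)) induced.
Proof.
apply/isomP; split; first exact: injm_induced.
apply/setP => s; apply/morphimP/idP => [[g Ng _ ->]|s_aut].
  apply/poset_autP => x y.
  rewrite !cycle_poset_leE !val_induced //.
  apply/subsetP/subsetP => [gxy i xi | xy _ /imsetP[i xi ->]]; last first.
    by rewrite mem_imset ?xy //; exact: perm_inj.
  have := gxy (g i); rewrite !mem_imset; try exact: perm_inj.
  exact.
have [g gE] := poset_aut_induced s_aut.
have Ng : g \in stab.
  apply/astabs_cycle_posetP => A A_in.
  by rewrite -(gE (CyclePoset A_in)) cycle_poset_valP.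
by exists g => //; apply/permP => x; apply: val_inj; rewrite val_induced.
Qed.

End Points.

(** * Permutations of the points that preserve the family are dihedral *)

Section Stabiliser.

Import GRing.Theory GroupScope.
Variable m : nat.
Local Notation n := m.+2.
Implicit Types (i j : 'I_n) (g : {perm 'I_n}).

Local Notation stab := 'N([set A | @in_cycle_poset n A] | 'P^*).

Lemma ordS_addr i : ordS i = (i + 1)%R.
Proof. by apply: val_inj; rewrite /= -addn1 modnDmr. Qed.

Lemma rotation_addr i : rotation n i = (i + 1)%R.
Proof. by rewrite permE ordS_addr. Qed.

Lemma reflection_oppr i : reflection n i = (- i)%R.
Proof. by apply: val_inj; rewrite /= reflectionE. Qed.

Lemma rotationX_addr k i : (rotation n ^+ k) i = (i + k%:R)%R.
Proof.
elim: k => [|k IHk]; first by rewrite perm1 addr0.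
by rewrite expgSr permM IHk rotation_addr -addrA -mulrSr.
Qed.

Lemma dihedral_sub_astabs : dihedral n \subset stab.
Proof.
rewrite gen_subG; apply/subsetP => g; rewrite in_set2 => /orP[]/eqP ->.
  apply/astabs_cycle_posetP => A /existsP[i /orP[]/eqP ->].
    by rewrite imset_set1 in_cycle_poset1.
  by rewrite imsetU1 imset_set1 !permE in_cycle_poset2.
apply/astabs_cycle_posetP => A /existsP[i /orP[]/eqP ->].
  by rewrite imset_set1 in_cycle_poset1.
rewrite imsetU1 imset_set1 !reflection_oppr ordS_addr setUC.
have -> : (- i = ordS (- (i + 1)))%R by rewrite ordS_addr opprD addrNK.
exact: in_cycle_poset2.
Qed.

(** An edge is mapped to an edge and not to a singleton, since g is
    injective. *)
Lemma astabs_cycle_poset_adjacent g i :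
  g \in stab -> g (i + 1)%R = (g i + 1)%R \/ g (i + 1)%R = (g i - 1)%R.
Proof.
move=> /astabs_cycle_posetP/(_ _ (in_cycle_poset2 i)).
rewrite imsetU1 imset_set1 ordS_addr => /existsP[k gk].
have neq_g : g (i + 1)%R != g i.
  by rewrite (inj_eq perm_inj) -subr_eq0 addrC addKr oner_eq0.
have [gik gSik] : g i \in [set k; ordS k] /\ g (i + 1)%R \in [set k; ordS k].
  case/orP: gk => /eqP gkE; last by rewrite -gkE set21 set22.
  by rewrite !(in_set2 _ k) -!(in_set1 _ k) -gkE set21 set22.
move: gik gSik neq_g; rewrite !inE ordS_addr.
case/orP=> /eqP->; case/orP=> /eqP->; rewrite ?eqxx // => _; first by left.
by right; rewrite addrK.
Qed.

(** Two consecutive fixed points leave no freedom further along the cycle, so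
    the induction carries the two of them. *)
Lemma astabs_cycle_poset_rigid g :
  g \in stab -> g 0%R = 0%R -> g 1%R = 1%R -> g = 1.
Proof.
move=> Ng g0 g1.
have fixed k : g k%:R%R = k%:R%R /\ g k.+1%:R%R = k.+1%:R%R.
  elim: k => [|k [gk gSk]]; first by [].
  split=> //; have [|] := astabs_cycle_poset_adjacent k.+1%:R%R Ng.
    by rewrite gSk -mulrSr.
  (* Stepping back to k contradicts injectivity unless k + 2 = k modulo n. *)
  rewrite gSk -mulrSr [in RHS]mulrSr addrK -[in RHS]gk => /perm_inj k2E.
  by rewrite k2E gk.
by apply/permP => i; rewrite perm1 -[i]natr_Zp; case: (fixed i).
Qed.

Lemma astabs_cycle_poset : stab = dihedral n.
Proof.
apply/eqP; rewrite eqEsubset dihedral_sub_astabs andbT.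
apply/subsetP => g Ng.
have Dr : rotation n \in dihedral n by rewrite mem_gen ?set21.
have Df : reflection n \in dihedral n by rewrite mem_gen ?set22.
(* The rotation by g 0, preceded by the reflection when g reverses the
   orientation of the edge from 0 to 1, agrees with g at 0 and 1. *)
suff [d Dd [d0 d1]] :
    exists2 d, d \in dihedral n & d 0%R = g 0%R /\ d 1%R = g 1%R.
  rewrite -(mulgKV d g) (_ : g * d^-1 = 1) ?mul1g //.
  apply: astabs_cycle_poset_rigid.
  - by rewrite groupM // groupV (subsetP dihedral_sub_astabs).
  - by rewrite permM -d0 permK.
  - by rewrite permM -d1 permK.
have [] := astabs_cycle_poset_adjacent 0%R Ng; rewrite add0r => ->.
  exists (rotation n ^+ g 0%R); first by rewrite groupX.
  by rewrite !rotationX_addr natr_Zp add0r addrC.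
exists (reflection n * rotation n ^+ g 0%R); first by rewrite groupM ?groupX.
by rewrite !permM !rotationX_addr !reflection_oppr natr_Zp oppr0 add0r addrC.
Qed.

End Stabiliser.

Theorem proposition2p3p9 (n : nat) (hn : 2 <= n) :
  exists2 f : {morphism dihedral n >-> {perm cycle_poset n}},
    isom (dihedral n) (poset_aut (cycle_poset n)) f
  & forall (g : {perm 'I_n}) (x : cycle_poset n),
      g \in dihedral n -> val (f g x) = [set g i | i in val x].
Proof.
case: n hn => [|[|m]] // _.
have sDN := dihedral_sub_astabs m.
have [f [fE _ _ _]] :=
  restrmP (actperm (subaction (cycle_poset m.+2) 'P^*)) sDN.
exists f => [|g x Dg]; last by rewrite fE val_induced // (subsetP sDN).
by rewrite fE -astabs_cycle_poset isom_induced.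
Qed.
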